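(* Let $m,n$ be positive integers with $2m+1<2n$. Let $2n=(2m+1)\ell+r$, where $0\le r\le 2m$ and $\ell\ge 1$ are integers, and let $\ell+r=2m\ell'+r'$, where $0\le r'<2m$ and $\ell'\ge 0$ are integers. If $1\le r\le m$ and $(r',\ell')\notin\{1,2,\dots,m\}\times\{0\}$, then $$\left\lceil \frac{4n}{2m+1}\right\rceil \le \gamma_{\times 2,t}(H_{2m+1,2n}) \le \left\lceil \frac{4n}{2m+1}\right\rceil +1,$$ and otherwise $$\gamma_{\times 2,t}(H_{2m+1,2n})=\left\lceil \frac{4n}{2m+1}\right\rceil.$$
   Context: All graphs are finite and simple; $N(x)$ denotes the open neighborhood of a vertex $x$. For a graph $G$ with minimum degree at least $2$, a subset $S\subseteq V(G)$ is a double total dominating set (2TDS) of $G$ if $|N(x)\cap S|\ge 2$ for every $x\in V(G)$. The double total domination number $\gamma_{\times 2,t}(G)$ is the minimum cardinality of a double total dominating set of $G$. Harary graph $H_{p,q}$ with $p$ odd, $q$ even and $p<q$: place $q$ vertices $1,2,\dots,q$ around a circle, equally spaced, and make each vertex adjacent to the nearest $\frac{p-1}{2}$ vertices in each direction around the circle and to the diametrically opposite vertex. *)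

(* Defs.v *)
From HB Require Import structures.
From mathcomp Require Import all_boot all_order all_algebra.
From mathcomp Require Import zify.

Set Implicit Arguments.
Unset Strict Implicit.
Unset Printing Implicit Defensive.

Record sgraph := SGraph {
  vertex :> finType;
  adj : rel vertex;
  adj_sym : symmetric adj;
  adj_irrefl : irreflexive adj }.

Definition nbhd (G : sgraph) (x : G) : {set G} := [set y | adj x y].

Definition double_total_dominating (G : sgraph) (S : {set G}) : bool :=
  [forall x : G, 2 <= #|nbhd x :&: S|].

(* Meaningful when the minimum degree is at least 2: the default value [setT]
   is then itself a double total dominating set, see [dtd_setT]. *)
Definition double_total_domination_number (G : sgraph) : nat :=
  #|[arg min_(S < [set: G] | double_total_dominating S) #|S| ]|.

Lemma dtd_setT (G : sgraph) :
  double_total_dominating [set: G] = [forall x : G, 2 <= #|nbhd x|].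
Proof. by apply: eq_forallb => x; rewrite setIT. Qed.

(* The vertices 'I_q are placed around a circle in the order 0, 1, ..., q-1. *)
Definition cw_steps (q : nat) (i j : 'I_q) : nat := (j + (q - i)) %% q.

Definition circ_dist (q : nat) (i j : 'I_q) : nat :=
  minn (cw_steps i j) (cw_steps j i).

(* For q even, j is diametrically opposite to i iff [circ_dist i j = q./2]. *)
Definition harary_adj (p q : nat) : rel 'I_q := fun i j =>
  (i != j) && ((circ_dist i j <= p.-1./2) || (circ_dist i j == q./2)).

Lemma harary_adj_sym p q : symmetric (@harary_adj p q).
Proof.
by move=> i j; rewrite /harary_adj eq_sym /circ_dist [minn (cw_steps i j) _]minnC.
Qed.

Lemma harary_adj_irrefl p q : irreflexive (@harary_adj p q).
Proof. by move=> i; rewrite /harary_adj eqxx. Qed.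

(* The Harary graph H_{p,q}, for p odd, q even and p < q. *)
Definition harary (p q : nat) : sgraph :=
  SGraph (@harary_adj_sym p q) (@harary_adj_irrefl p q).

Lemma harary_min_degree (p q : nat) (x : harary p q) :
  2 < p -> p < q -> 2 <= #|nbhd x|.
Proof.
case: x => a ha hp hpq.
have q0 : 0 < q by lia.
have p1 : 1 <= p.-1./2 by lia.
have neq_xy : a != (if a.+1 == q then 0 else a.+1) by case: (a.+1 =P q); lia.
have neq_xz : a != (if a == 0 then q.-1 else a.-1) by case: (a =P 0); lia.
have neq_yz : (if a.+1 == q then 0 else a.+1) != (if a == 0 then q.-1 else a.-1).
  by case: (a.+1 =P q); case: (a =P 0); lia.
pose x : 'I_q := Ordinal ha.
pose y : 'I_q := Ordinal (ltn_pmod (a + 1) q0).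
pose z : 'I_q := Ordinal (ltn_pmod (a + (q - 1)) q0).
have Ey : val y = if a.+1 == q then 0 else a.+1.
  rewrite /= addn1; case: eqP => [->|?]; first exact: modnn.
  by rewrite modn_small //; lia.
have Ez : val z = if a == 0 then q.-1 else a.-1.
  rewrite /=; case: eqP => [-> |?]; first by rewrite modn_small; lia.
  have -> : a + (q - 1) = a.-1 + q by lia.
  by rewrite modnDr modn_small //; lia.
have cy : cw_steps x y = 1.
  rewrite /cw_steps /= modnDml.
  have -> : a + 1 + (q - a) = 1 + q by lia.
  by rewrite modnDr modn_small //; lia.
have cz : cw_steps z x = 1.
  rewrite /cw_steps -[nat_of_ord z]/(val z) Ez /=; case: eqP => [-> |?].
    have -> : 0 + (q - q.-1) = 1 by lia.
    by rewrite modn_small //; lia.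
  have -> : a + (q - a.-1) = 1 + q by lia.
  by rewrite modnDr modn_small //; lia.
have xy : harary_adj p x y.
  by rewrite /harary_adj /circ_dist cy geq_min p1 andbT -val_eqE Ey.
have xz : harary_adj p x z.
  by rewrite /harary_adj /circ_dist cz geq_min p1 orbT andbT -val_eqE Ez.
have yz : y != z.
  by rewrite -val_eqE Ey Ez.
have <- : #|[set y; z]| = 2 by rewrite cards2 yz.
apply: subset_leq_card; apply/subsetP => u.
by rewrite !inE => /orP[] /eqP ->.
Qed.

(* Main.v *)
Require Import Defs.
From mathcomp Require Import all_boot all_order all_algebra.
From mathcomp Require Import zify.
Import Order.TTheory GRing.Theory Num.Theory.
Local Open Scope nat_scope.

(* Counting the pairs (x, y) with y in S and x in N(y) gives
   2 * 2n <= |S| * (2m + 1), the graph being (2m + 1)-regular.  Conversely,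
   spread K points evenly around the circle, at the positions floor (j * 2n / K).
   For K = 2 * ceil (2n / (2m + 1)) two consecutive gaps sum to at most 2m + 1
   and the set is invariant under the antipodal map, so it is double total
   dominating; K exceeds ceil (4n / (2m + 1)) only when 1 <= r <= m, and then
   by 1.  If moreover l + r <= m, then 2n <= (2l + 1) * m, so K = 2l + 1 points
   already have all gaps at most m, and every vertex sees the nearest point of
   the set strictly before it and strictly after it. *)

(** * Adjacency and degrees in the Harary graph *)

Lemma cw_stepsE q (i j : 'I_q) :
  cw_steps i j = if i <= j then j - i else j + q - i.
Proof.
have := ltn_ord i; have := ltn_ord j; rewrite /cw_steps => hj hi.
case: ifP => hij; last by rewrite modn_small; lia.
have -> : j + (q - i) = j - i + q by lia.
by rewrite modnDr modn_small //; lia.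
Qed.

(** A form free of moduli, from which [lia] can decide adjacency: the two arcs between [i] and [j]
    have lengths [maxn i j - minn i j] and its complement to [2 * n]. *)
Lemma harary_adjP m n (i j : 'I_(2 * n)) : m < n ->
  reflect (nat_of_ord i <> j /\
     (maxn i j - minn i j <= m \/ 2 * n - m <= maxn i j - minn i j \/
      maxn i j - minn i j = n))
    (harary_adj (2 * m + 1) i j).
Proof.
move=> mn; apply: (equivP idP); have := ltn_ord i; have := ltn_ord j.
rewrite /harary_adj /circ_dist !cw_stepsE -val_eqE /=.
by case: (leqP i j); case: (leqP j i) => ? ? ? ?; split; lia.
Qed.

Lemma card_nbhd_harary m n (x : harary (2 * m + 1) (2 * n)) : m < n ->
  #|nbhd x| <= 2 * m + 1.
Proof.
move=> mn; have N0 : 0 < 2 * n by lia.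
(* Index [d] encodes the offset [d - m]; the index [m], whose offset would be zero, is reassigned to
   the antipode. *)
pose f (d : 'I_(2 * m + 1)) : 'I_(2 * n) :=
  Ordinal (ltn_pmod (x + (if d == m :> nat then n else 2 * n + d - m)) N0).
apply: leq_trans (_ : #|f @: [set: 'I_(2 * m + 1)]| <= _); last first.
  by apply: leq_trans (leq_imset_card _ _) _; rewrite cardsT card_ord.
apply/subset_leq_card/subsetP => y; rewrite inE => /harary_adjP -/(_ mn) [neq H].
have hx := ltn_ord x; have hy := ltn_ord y.
have [d dlt [q E]] : exists2 d, d < 2 * m + 1 & exists q,
    x + (if d == m then n else 2 * n + d - m) = q * (2 * n) + y.
  have [E|ne] := eqVneq (maxn x y - minn x y) n.
    by exists m; [lia | rewrite eqxx; exists (x + n >= 2 * n); lia].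
  have [?|?] := leqP (maxn x y - minn x y) m.
    exists (m + y - x); first by lia.
    by rewrite ifF; [exists 1; lia | lia].
  have [?|?] := leqP x y.
    exists (m + y - x - 2 * n); first by lia.
    by rewrite ifF; [exists 0; lia | lia].
  exists (m + y + 2 * n - x); first by lia.
  by rewrite ifF; [exists 2; lia | lia].
apply/imsetP; exists (Ordinal dlt); first by rewrite inE.
by apply: val_inj; rewrite /= E modnMDl modn_small.
Qed.

(** * Bounding the double total domination number *)

Lemma double_total_dominatingP (G : sgraph) (S : {set G}) :
  reflect (forall x : G, exists y z,
      [/\ y != z, adj x y, adj x z, y \in S & z \in S])
    (double_total_dominating S).
Proof.
apply: (iffP forallP) => H x; have := H x.
  case/card_gt1P => y [z [yS zS ?]]; exists y, z; move: yS zS.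
  by rewrite !inE => /andP[-> ->] /andP[-> ->].
move=> [y [z [? xy xz yS zS]]]; apply/card_gt1P; exists y, z.
by rewrite !inE xy xz yS zS.
Qed.

Lemma double_total_domination_number_le (G : sgraph) (S : {set G}) :
  double_total_dominating [set: G] -> double_total_dominating S ->
  double_total_domination_number G <= #|S|.
Proof.
move=> dT dS; rewrite /double_total_domination_number.
by case: arg_minnP => // A _; apply.
Qed.

Lemma double_total_domination_number_ge (G : sgraph) (k : nat) :
  double_total_dominating [set: G] -> (forall x : G, #|nbhd x| <= k) ->
  2 * #|G| <= double_total_domination_number G * k.
Proof.
move=> dT deg; rewrite /double_total_domination_number.
case: arg_minnP => // S /forallP dS _.
have -> : 2 * #|G| = \sum_(x : G) 2 by rewrite sum_nat_const mulnC.
apply: (@leq_trans (\sum_(x : G) #|nbhd x :&: S|)); first exact: leq_sum.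
under eq_bigr => x _.
  rewrite -sum1_card (eq_bigl (fun y => (y \in S) && adj x y)); last first.
    by move=> y; rewrite !inE andbC.
  over.
rewrite (exchange_big_dep (mem S)) /=; last by move=> x y _ /andP[].
rewrite -sum_nat_const; apply: leq_sum => y yS.
rewrite sum1_card; apply: leq_trans (deg y).
by apply/subset_leq_card/subsetP => x; rewrite !inE unfold_in yS adj_sym.
Qed.

(** * Evenly spread points *)

Definition spread (N K j : nat) : nat := j * N %/ K.

Section Spread.

Variables (N K : nat).
Hypotheses (N_gt0 : 0 < N) (K_gt0 : 0 < K).

Definition circle_pt (j : nat) : 'I_N := Ordinal (ltn_pmod j N_gt0).

Definition spread_set : {set 'I_N} :=
  [set circle_pt (spread N K j) | j : 'I_K].

Lemma card_spread_set : #|spread_set| <= K.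
Proof. by apply: leq_trans (leq_imset_card _ _) _; rewrite card_ord. Qed.

Lemma spreadDK j : spread N K (j + K) = spread N K j + N.
Proof. by rewrite /spread mulnDl addnC [K * N]mulnC divnMDl // addnC. Qed.

Lemma spread_in j : circle_pt (spread N K j) \in spread_set.
Proof.
apply/imsetP; exists (Ordinal (ltn_pmod j K_gt0)) => //; apply: val_inj => /=.
rewrite /spread {1}(divn_eq j K) mulnDl mulnAC divnMDl //.
by rewrite modnMDl.
Qed.

(** Rounding costs nothing: the floor bound amounts to [j * N < a.+1 * K], to which [b * N <= c * K]
    can be added. *)
Lemma spread_step a b c j : b * N <= c * K -> spread N K j <= a ->
  spread N K (j + b) <= a + c.
Proof.
rewrite /spread => h; rewrite -ltnS ltn_divLR // => ja.
by rewrite -ltnS ltn_divLR // -addSn !mulnDl -addSn leq_add.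
Qed.

Lemma spread_ltS j : K <= N -> spread N K j < spread N K j.+1.
Proof.
move=> h; rewrite /spread leq_divRL //; have := leq_trunc_div (j * N) K; nia.
Qed.

Lemma spread_succ_gt a : exists i, spread N K i <= a < spread N K i.+1.
Proof.
have ex : exists i, a < spread N K i.
  by exists (a.+1 * K); rewrite /spread leq_divRL //; nia.
case: (ex_minnP ex) => [[|i]]; first by rewrite /spread mul0n div0n.
move=> h1 h2; exists i; rewrite h1 andbT leqNgt.
by apply/negP => /h2; rewrite ltnn.
Qed.

End Spread.

Arguments circle_pt {N} N_gt0 j.

(** * Spread points as dominating sets *)

Lemma circle_pt_neq N (N_gt0 : 0 < N) a b :
  a < b -> b < a + N -> circle_pt N_gt0 a != circle_pt N_gt0 b.
Proof.
move=> ab ba; apply/eqP => /(congr1 val) /= /esym /eqP.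
by rewrite eqn_mod_dvd ?gtnNdvd //; lia.
Qed.

(* The target is lifted to the integer line around [x + 2 * n] rather than [x]
   to avoid truncated subtraction. *)
Lemma harary_adj_circle_pt m n (N_gt0 : 0 < 2 * n) (x : 'I_(2 * n)) b :
  m < n -> b != x + 2 * n ->
  (x + 2 * n - m <= b <= x + 2 * n + m) || (b == x + 2 * n + n) ->
  harary_adj (2 * m + 1) x (circle_pt N_gt0 b).
Proof.
move=> mn nb hb; have hx := ltn_ord x.
have [q [y [ylt E]]] : exists q y, y < 2 * n /\ b = q * (2 * n) + y.
  by exists (b %/ (2 * n)), (b %% (2 * n)); rewrite ltn_mod N_gt0 -divn_eq.
have Ey : circle_pt N_gt0 b = y :> nat by rewrite /= E modnMDl modn_small.
(* Both alternatives give [b < 5 * n]. *)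
have q3 : q < 3 by nia.
apply/harary_adjP => //; rewrite Ey.
by case: q q3 E => [|[|[|//]]] _ E; lia.
Qed.

(* With an even number of points the set is invariant under [x |-> x + n], so a
   vertex of the set trades itself for its opposite, and it suffices that every
   window of [2 * m + 1] consecutive vertices contains two points. *)
Lemma spread_dominating_even m n K (N_gt0 : 0 < 2 * n) :
  m < n -> 0 < K -> 2 * K <= 2 * n -> 2 * n <= (2 * m + 1) * K ->
  double_total_dominating
    (spread_set (2 * n) (2 * K) N_gt0 : {set harary (2 * m + 1) (2 * n)}).
Proof.
move=> mn K0 KN hK; apply/double_total_dominatingP => x.
have K2 : 0 < 2 * K by lia.
have hx := ltn_ord x; set t := spread (2 * n) (2 * K).
(* The window around [x] starts just after this position, so [t i.+1] is the first point that can
   lie in it. *)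
have [i /andP[lo hi]] :=
  spread_succ_gt (2 * n) (2 * K) N_gt0 K2 (x + 2 * n - m - 1).
have up : t i.+2 <= x + 2 * n + m.
  have -> : x + 2 * n + m = x + 2 * n - m - 1 + (2 * m + 1) by lia.
  by rewrite -addn2; apply: spread_step => //; lia.
have lt12 := spread_ltS (2 * n) (2 * K) N_gt0 K2 i.+1 KN; rewrite -!/t in hi lt12.
have tin j : circle_pt N_gt0 (t j) \in spread_set (2 * n) (2 * K) N_gt0.
  exact: spread_in.
have tn j : t (j + K) = t j + n.
  rewrite /t /spread mulnDl.
  have -> : K * (2 * n) = n * (2 * K) by lia.
  by rewrite addnC divnMDl // addnC.
have [e1|n1] := eqVneq (t i.+1) (x + 2 * n).
  exists (circle_pt N_gt0 (t i.+2)), (circle_pt N_gt0 (t (i.+1 + K))); split=> //.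
  - by apply: circle_pt_neq; rewrite tn; lia.
  - by apply: harary_adj_circle_pt => //; lia.
  - by apply: harary_adj_circle_pt => //; rewrite tn; lia.
have [e2|n2] := eqVneq (t i.+2) (x + 2 * n).
  exists (circle_pt N_gt0 (t i.+1)), (circle_pt N_gt0 (t (i.+2 + K))); split=> //.
  - by apply: circle_pt_neq; rewrite tn; lia.
  - by apply: harary_adj_circle_pt => //; lia.
  - by apply: harary_adj_circle_pt => //; rewrite tn; lia.
exists (circle_pt N_gt0 (t i.+1)), (circle_pt N_gt0 (t i.+2)); split=> //.
- by apply: circle_pt_neq; lia.
- by apply: harary_adj_circle_pt => //; lia.
- by apply: harary_adj_circle_pt => //; lia.
Qed.

Lemma spread_dominating_gap m n K (N_gt0 : 0 < 2 * n) :
  m < n -> 0 < K -> K <= 2 * n -> 2 * n <= m * K ->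
  double_total_dominating
    (spread_set (2 * n) K N_gt0 : {set harary (2 * m + 1) (2 * n)}).
Proof.
move=> mn K0 KN hK; apply/double_total_dominatingP => x.
have hx := ltn_ord x; set t := spread (2 * n) K.
(* Thus [t i] is strictly before the lifted [x]; if [t i.+1] hits [x] itself, [t i.+2] replaces it
   below. *)
have [i /andP[lo hi]] := spread_succ_gt (2 * n) K N_gt0 K0 (x + 2 * n - 1).
have gap j : t j.+1 <= t j + m.
  by rewrite -addn1; apply: spread_step; rewrite ?mul1n.
have g1 := gap i; have g2 := gap i.+1.
have l1 := spread_ltS (2 * n) K N_gt0 K0 i KN.
have l2 := spread_ltS (2 * n) K N_gt0 K0 i.+1 KN.
rewrite -!/t in lo hi l1 l2.
have tin j : circle_pt N_gt0 (t j) \in spread_set (2 * n) K N_gt0.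
  exact: spread_in.
have [e1|n1] := eqVneq (t i.+1) (x + 2 * n).
  exists (circle_pt N_gt0 (t i)), (circle_pt N_gt0 (t i.+2)); split=> //.
  - by apply: circle_pt_neq; lia.
  - by apply: harary_adj_circle_pt => //; lia.
  - by apply: harary_adj_circle_pt => //; lia.
exists (circle_pt N_gt0 (t i)), (circle_pt N_gt0 (t i.+1)); split=> //.
- by apply: circle_pt_neq; lia.
- by apply: harary_adj_circle_pt => //; lia.
- by apply: harary_adj_circle_pt => //; lia.
Qed.

(** * The ceiling and the final case analysis *)

Lemma ceil_ratn (a b c : nat) : 0 < b -> a <= c * b -> c * b < a + b ->
  Num.ceil (a%:R / b%:R : rat)%R = (c%:Z)%R.
Proof.
move=> b0 h1 h2; apply: ceil_def; have b0' : (0 < b%:R :> rat)%R by rewrite ltr0n.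
rewrite ltr_pdivlMr // ler_pdivrMr // intrB -!pmulrn mulrBl mul1r ltrBlDr.
by rewrite -!natrM -natrD ltr_nat ler_nat h1 h2.
Qed.

Local Open Scope ring_scope.

Theorem theorem2p3 (m n l r l' r' : nat)
  (m_gt0 : (0 < m)%N) (n_gt0 : (0 < n)%N)
  (lt_mn : (2 * m + 1 < 2 * n)%N)
  (div_n : (2 * n = (2 * m + 1) * l + r)%N)
  (r_le : (r <= 2 * m)%N) (l_ge1 : (1 <= l)%N)
  (div_lr : (l + r = 2 * m * l' + r')%N)
  (r'_lt : (r' < 2 * m)%N) :
  let gamma : int :=
    (double_total_domination_number (harary (2 * m + 1) (2 * n)))%:Z in
  let c : int := Num.ceil ((4 * n)%:R / (2 * m + 1)%:R : rat) in
  let P : Prop :=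
    (1 <= r <= m)%N /\ ~ ((1 <= r' <= m)%N /\ l' = 0%N) in
  (P -> c <= gamma <= c + 1) /\ (~ P -> gamma = c).
Proof.
move=> gamma c P.
have mn : (m < n)%N by lia.
have N_gt0 : (0 < 2 * n)%N by lia.
(* The remainder contributes the ceiling of [2 * r / (2 * m + 1)], which is 0 for [r = 0], 1 for
   [1 <= r <= m] and 2 beyond. *)
have cE : c = (2 * l + (0 < r) + (m < r))%N.
  rewrite /c; apply: ceil_ratn; first by lia.
    by case: (ltnP 0 r); case: (ltnP m r) => /=; nia.
  by case: (ltnP 0 r); case: (ltnP m r) => /=; nia.
have dT : double_total_dominating [set: harary (2 * m + 1) (2 * n)].
  rewrite dtd_setT; apply/forallP => x; apply: harary_min_degree => //; lia.
rewrite {}cE {c} /gamma {gamma}; set g := double_total_domination_number _.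
have lower : (2 * l + (0 < r) + (m < r) <= g)%N.
  have deg (x : harary (2 * m + 1) (2 * n)) : (#|nbhd x| <= 2 * m + 1)%N.
    exact: card_nbhd_harary.
  have := double_total_domination_number_ge _ _ dT deg.
  by rewrite card_ord -/g; case: (ltnP 0 r); case: (ltnP m r) => /=; nia.
have even_upper : (g <= 2 * (l + (0 < r)))%N.
  apply: leq_trans (card_spread_set (2 * n) _ N_gt0).
  apply: double_total_domination_number_le => //.
  by apply: spread_dominating_even => //; case: (ltnP 0 r) => /=; nia.
have gap_upper : (l + r <= m)%N -> (g <= 2 * l + 1)%N.
  move=> lr; apply: leq_trans (card_spread_set (2 * n) _ N_gt0).
  apply: double_total_domination_number_le => //.
  by apply: spread_dominating_gap => //; nia.
split=> [[hr _]|nP]; first by lia.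
have [hr|hr] := boolP (1 <= r <= m)%N; last by lia.
(* Only the excluded pairs remain; there [l' = 0] gives [l + r = r' <= m], the case of
   [gap_upper]. *)
have [h1 h2] : (1 <= r' <= m)%N /\ l' = 0%N.
  have [//|] := boolP ((1 <= r' <= m) && (l' == 0))%N; first by case/andP => ? /eqP.
  by move=> h; case: nP; split=> // -[h1 h2]; rewrite h1 h2 in h.
have : (g <= 2 * l + 1)%N by apply: gap_upper; subst l'; lia.
by lia.
Qed.
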